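(* The map $f:B(r,N)\mapsto\{B(r(p^{e_p(N)}),p^{e_p(N)}):p\in\mathcal P\}$ is a homeomorphism of the additive boundary $\Omega_B$ onto the product space $\prod_{p\in\mathcal P}X_p$.
   Context: $\mathcal P$ is the set of primes; $\mathbb N=\{0,1,2,\dots\}$; $\mathbb N^\times$ is the multiplicative semigroup of positive integers; $P=\mathbb N\rtimes\mathbb N^\times$ has product $(m,a)(n,b)=(m+an,ab)$ and partial order $(m,a)\le(n,b)\iff a^{-1}(n-m)\in\mathbb N$ and $a^{-1}b\in\mathbb N^\times$. The Nica spectrum $\Omega$ is the set of nonempty hereditary (downward closed in $P$) directed subsets of $P$, with the topology inherited from the product space $\{0,1\}^P$. Supernatural numbers are formal products $N=\prod_{p\in\mathcal P}p^{e_p(N)}$ with $e_p(N)\in\mathbb N\cup\{\infty\}$; their set is $\mathcal N$, and $M\mid N$ means $e_p(M)\le e_p(N)$ for all $p$. For $N\in\mathcal N$, $\mathbb Z/N:=\varprojlim\{\mathbb Z/a\mathbb Z:a\in\mathbb N^\times,a\mid N\}$, and for $M\mid N$, $r(M)\in\mathbb Z/M$ is the image of $r\in\mathbb Z/N$ under the canonical map (so for $a\in\mathbb N^\times$, $r(a)$ is a residue class mod $a$). For $N\in\mathcal N$, $r\in\mathbb Z/N$, $B(r,N):=\{(m,a)\in P:a\mid N\text{ and }m\in r(a)\}\in\Omega$; distinct pairs $(r,N)$ give distinct sets. The additive boundary is $\Omega_B:=\{B(r,N):N\in\mathcal N,\ r\in\mathbb Z/N\}\subset\Omega$, and for $p\in\mathcal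 P$, $X_p:=\{B(r,p^k):k\in\mathbb N\cup\{\infty\},\ r\in\mathbb Z/p^k\}\subset\Omega$, both with the subspace topology. *)

(* Defs.v *)
From HB Require Import structures.
From mathcomp Require Import all_boot.
From mathcomp Require Import all_classical all_reals all_analysis.

Set Implicit Arguments.
Unset Strict Implicit.
Unset Printing Implicit Defensive.

Local Open Scope classical_set_scope.

Definition posnat : Type := {n : nat | 0 < n}.
Definition nat_of_posnat (a : posnat) : nat := val a.
Coercion nat_of_posnat : posnat >-> nat.

Lemma posnat_gt0 (a : posnat) : 0 < a. Proof. exact: valP a. Qed.

Lemma posnat_mul_gt0 (a b : posnat) : 0 < a * b.
Proof. by rewrite muln_gt0 !posnat_gt0. Qed.

Definition mul_posnat (a b : posnat) : posnat :=
  Sub (a * b) (posnat_mul_gt0 a b).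

(* The semigroup P, the semidirect product of N by N^x. *)
Definition semi : Type := (nat * posnat)%type.

Definition mul_semi (x y : semi) : semi := (x.1 + x.2 * y.1, mul_posnat x.2 y.2).

Definition le_semi (x y : semi) : bool :=
  [&& x.1 <= y.1, x.2 %| y.1 - x.1 & x.2 %| y.2].

(* The order is left divisibility in the semidirect product. *)
Lemma le_semi_mul (x y : semi) : le_semi x y <-> exists z, y = mul_semi x z.
Proof.
case: x y => m a [n b]; split=> [/and3P[/= mn /dvdnP[k nm] /dvdnP[c bE]]|].
  have c0 : 0 < c by have := posnat_gt0 b; rewrite bE muln_gt0 => /andP[].
  exists (k, Sub c c0); congr pair; first by rewrite /= mulnC -nm subnKC.
  by apply: val_inj => /=; rewrite mulnC.
move=> [[k c] [-> ->]]; apply/and3P; split=> //=; first exact: leq_addr.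
  by rewrite addKn dvdn_mulr.
exact: dvdn_mulr.
Qed.

Definition hereditary (A : semi -> bool) : Prop :=
  forall x y, A y -> le_semi x y -> A x.

Definition directed (A : semi -> bool) : Prop :=
  forall x y, A x -> A y -> exists z, [/\ A z, le_semi x z & le_semi y z].

(* Subsets of P are points of the product space {0,1}^P. *)
Definition Omega : set {ptws semi -> bool} :=
  [set A : {ptws semi -> bool} |
    [/\ exists x, A x, hereditary A & directed A]].

Definition primes_type : Type := {p : nat | prime p}.
Definition nat_of_prime (p : primes_type) : nat := val p.
Coercion nat_of_prime : primes_type >-> nat.

(* Exponents in N U {oo}; [None] stands for oo. *)
Definition exponent : Type := option nat.

Definition le_exponent (e f : exponent) : bool :=
  match e, f with
  | _, None => true
  | None, Some _ => false
  | Some m, Some n => m <= n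
  end.

(* A supernatural number N is its exponent function p |-> e_p(N). *)
Definition supernatural : Type := primes_type -> exponent.

Definition dvds (M N : supernatural) : Prop :=
  forall p, le_exponent (M p) (N p).

Definition supernatural_of (a : posnat) : supernatural :=
  fun p => Some (logn p a).

Definition ppow (p : primes_type) (k : exponent) : supernatural :=
  fun q => if val q == val p then k else Some 0.

Lemma dvds_trans (L M N : supernatural) : dvds L M -> dvds M N -> dvds L N.
Proof.
move=> LM MN p; move: (LM p) (MN p).
by case: (L p) (M p) (N p) => [l|] [m|] [n|] //=; exact: leq_trans.
Qed.

Lemma ppow_dvds (p : primes_type) (N : supernatural) : dvds (ppow p (N p)) N.
Proof.
move=> q; rewrite /ppow; case: eqP => [/val_inj ->|_]; last by case: (N q).
by case: (N p) => /=.
Qed.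

Definition divisors_of (N : supernatural) : set posnat :=
  [set a | dvds (supernatural_of a) N].

Definition mk_divisor (N : supernatural) (c : posnat)
    (h : dvds (supernatural_of c) N) : divisors_of N :=
  exist _ c (mem_set h).

(* Z/N as the inverse limit of the Z/a for a | N. A residue class mod a is
   represented by its element in {0, ..., a - 1}; the transition map
   Z/b -> Z/a is then reduction mod a. *)
Record Zmods (N : supernatural) : Type := MkZmods {
  residue :> forall a : divisors_of N, 'I_(val a);
  residue_compat : forall a b : divisors_of N,
    val a %| val b -> residue b %% val a = residue a }.

Definition widen_divisor (M N : supernatural) (MN : dvds M N)
    (a : divisors_of M) : divisors_of N :=
  mk_divisor (dvds_trans (set_mem (valP a)) MN).

(* r |-> r(M) *)
Definition res (M N : supernatural) (MN : dvds M N) (r : Zmods N) : Zmods M :=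
  @MkZmods M (fun a => r (widen_divisor MN a))
    (fun a b => @residue_compat N r (widen_divisor MN a) (widen_divisor MN b)).

Definition Bset (N : supernatural) (r : Zmods N) : {ptws semi -> bool} :=
  fun x => `[< exists2 a : divisors_of N,
                 val a = x.2 & x.1 %% val a = r a >].

Lemma mem_Bset (N : supernatural) (r : Zmods N) (a : divisors_of N) (m : nat) :
  m %% val a = r a -> Bset r (m, val a).
Proof. by move=> ma; apply/asboolP; exists a. Qed.

Lemma dvds_nat (a b : posnat) :
  a %| b -> dvds (supernatural_of a) (supernatural_of b).
Proof. by move=> ab p; apply: dvdn_leq_log ab; exact: posnat_gt0. Qed.

Lemma dvds_one (N : supernatural) (a : posnat) :
  nat_of_posnat a = 1 -> dvds (supernatural_of a) N.
Proof. by move=> a1 p; rewrite /supernatural_of a1 logn1; case: (N p). Qed.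

Lemma lcm_gt0 (a b : posnat) : 0 < lcmn a b.
Proof. by rewrite lcmn_gt0 !posnat_gt0. Qed.

Lemma dvds_lcm (N : supernatural) (a b : posnat) :
  dvds (supernatural_of a) N -> dvds (supernatural_of b) N ->
  dvds (supernatural_of (Sub (lcmn a b) (lcm_gt0 a b))) N.
Proof.
move=> aN bN p; move: (aN p) (bN p); rewrite /supernatural_of /=.
rewrite logn_lcm ?posnat_gt0//.
by case: (N p) => //= n an bn; rewrite geq_max an bn.
Qed.

Lemma Bset_Omega (N : supernatural) (r : Zmods N) : Omega (Bset r).
Proof.
split.
- pose one : posnat := Sub 1 isT.
  pose d := mk_divisor (@dvds_one N one erefl).
  exists (r d : nat, val d); apply: mem_Bset.
  by rewrite modn_small //; exact: ltn_ord.
- move=> [m a] [n b'] /asboolP[b /= <- nb] /and3P[/= mn amn ab].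
  have aN : dvds (supernatural_of a) N.
    exact: dvds_trans (dvds_nat ab) (set_mem (valP b)).
  apply: (mem_Bset (a := mk_divisor aN)).
  rewrite -(residue_compat r (b := b)) //= -nb modn_dvdm //.
  by apply/esym/eqP; rewrite eqn_mod_dvd.
- move=> [m a'] [n b'] /asboolP[a /= <- ma] /asboolP[b /= <- nb].
  pose d := mk_divisor (dvds_lcm (set_mem (valP a)) (set_mem (valP b))).
  have bound (u e t : nat) : 0 < e -> u <= t -> u <= r d + e * t.
    by move=> e0 ut; apply/(leq_trans ut)/(leq_trans _ (leq_addl _ _))/leq_pmull.
  have cong (e : divisors_of N) u t : val e %| val d -> u %% val e = r e ->
      u <= r d + val d * t -> val e %| r d + val d * t - u.
    move=> ed ue ut; rewrite -eqn_mod_dvd // ue -(residue_compat r ed).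
    by rewrite -(modnDmr (r d)) (eqP (dvdn_mulr t ed)) addn0.
  have ad : val a %| val d by exact: dvdn_lcml.
  have bd : val b %| val d by exact: dvdn_lcmr.
  exists (r d + val d * (m + n), val d); split.
  + by apply: mem_Bset; rewrite mulnC addnC modnMDl modn_small //; exact: ltn_ord.
  + apply/and3P; split=> //=.
      by apply: bound; [exact: posnat_gt0|exact: leq_addr].
    by apply: cong => //; apply: bound; [exact: posnat_gt0|exact: leq_addr].
  + apply/and3P; split=> //=.
      by apply: bound; [exact: posnat_gt0|exact: leq_addl].
    by apply: cong => //; apply: bound; [exact: posnat_gt0|exact: leq_addl].
Qed.

Definition B (N : supernatural) (r : Zmods N) : Omega :=
  exist _ (Bset r) (mem_set (Bset_Omega r)).

Definition OmegaB : set Omega :=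
  [set x | exists (N : supernatural) (r : Zmods N), x = B r].

Definition Xp (p : primes_type) : set Omega :=
  [set x | exists (k : exponent) (r : Zmods (ppow p k)), x = B r].

Lemma B_OmegaB (N : supernatural) (r : Zmods N) : OmegaB (B r).
Proof. by exists N, r. Qed.

Lemma B_X (p : primes_type) (k : exponent) (r : Zmods (ppow p k)) : Xp p (B r).
Proof. by exists k, r. Qed.

(* B(r,N) as a point of the subspaces Omega_B and X_p *)
Definition Bbd (N : supernatural) (r : Zmods N) : OmegaB :=
  exist _ (B r) (mem_set (B_OmegaB r)).

Definition Bloc (p : primes_type) (k : exponent) (r : Zmods (ppow p k)) :
    Xp p :=
  exist _ (B r) (mem_set (B_X r)).

Definition homeomorphism (S T : topologicalType) (f : S -> T) : Prop :=
  continuous f /\ exists g : T -> S, [/\ cancel f g, cancel g f & continuous g].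

(* Main.v *)
(* On the level of subsets of P, the p-component of f keeps from A = B(r,N) the
   pairs (m,a) with a a power of p. By the Chinese remainder theorem, A is
   recovered from its components: (m,a) lies in A iff for every p the pair
   (m, p-part of a) lies in the p-component. Only the finitely many p dividing
   a matter, so in both directions each coordinate of the image depends on
   finitely many coordinates of the argument, and both maps are continuous. *)
Require Import Defs.
From mathcomp Require Import all_boot.
From mathcomp Require Import all_classical all_reals all_analysis.

Set Implicit Arguments.
Unset Strict Implicit.
Unset Printing Implicit Defensive.

Local Open Scope classical_set_scope.

(** * Simultaneous congruences for finitely many moduli *)

Lemma chinese_seq (I : eqType) (s : seq I) (F t : I -> nat) :
  uniq s -> {in s &, forall i j, i != j -> coprime (F i) (F j)} ->
  exists m, {in s, forall i, m = t i %[mod F i]}.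
Proof.
elim: s => [|i s IHs] /=; first by exists 0.
move=> /andP[is_ us] co.
have [|m mP] := IHs us.
  by move=> j k js ks; apply: co; rewrite inE ?js ?ks orbT.
have coP : coprime (F i) (\prod_(j <- s) F j).
  rewrite big_seq; elim/big_ind: _ => [|x y cx cy|j js].
  - exact: coprimen1.
  - by rewrite coprimeMr cx.
  - apply: co; rewrite ?inE ?eqxx ?js ?orbT //.
    by apply: contraNneq is_ => ->.
(* By [coP] the two-modulus theorem applies to [F i] and the product of the other moduli, for which
   [m] is a solution. *)
exists (chinese (F i) (\prod_(j <- s) F j) (t i) m) => j.
rewrite inE => /orP[/eqP->|js]; first exact: chinese_modl.
have jP : F j %| \prod_(k <- s) F k by rewrite (big_rem j) //= dvdn_mulr.
by rewrite -mP // -(modn_dvdm _ jP) chinese_modr // modn_dvdm.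
Qed.

(** * Continuity into products, into [bool], and into subspaces of [Omega] *)

Lemma continuous_prod (S : topologicalType) (I : Type)
    (T : I -> topologicalType) (f : S -> prod_topology T) :
  (forall i, continuous (fun s => f s i)) -> continuous f.
Proof.
move=> cf s; apply/cvg_sup => i.
exact: (@continuous_comp_initial _ S (T i) (fun g : prod_topology T => g i) f
  (cf i)).
Qed.

Lemma continuous_boolP (S : topologicalType) (f : S -> bool) :
  continuous f <-> forall s, \forall t \near s, f t = f s.
Proof.
split=> cf s; first by apply: (cf s [set b | b = f s]); exact/principal_filterP.
by move=> U /principal_filterP Us; apply: filterS (cf s) => t /= ->.
Qed.

(** Each [f i] is locally constant since [bool] is discrete, and finitely many neighbourhoods can be
    intersected. *)
Lemma continuous_all (S : topologicalType) (I : Type) (s : seq I)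
    (f : I -> S -> bool) :
  (forall i, continuous (f i)) -> continuous (fun x => all (f^~ x) s).
Proof.
move=> cf; apply/continuous_boolP => x; elim: s => [|i s IHs] /=.
  exact: nearW.
have /continuous_boolP/(_ x) := cf i.
by apply: filterS2 IHs => y -> ->.
Qed.

Definition points (A : set Omega) (x : A) : semi -> bool := set_val (set_val x).

Lemma points_inj (A : set Omega) : injective (@points A).
Proof. by move=> x y xy; apply/val_inj/val_inj. Qed.

Lemma points_continuous (A : set Omega) (x : semi) :
  continuous (fun y : A => points y x).
Proof.
move=> y.
apply: (continuous_comp
  (f := fun y : A => set_val (set_val y) : {ptws semi -> bool})
  (g := fun h => h x)); last exact: (@proj_continuous _ (fun=> bool) x).
apply: (continuous_comp
  (f := fun y : A => set_val y) (g := fun y : Omega => set_val y));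
  exact: initial_continuous.
Qed.

(** [A] has the initial topology from [Omega], and [Omega] the one from the product, so coordinates
    decide continuity. *)
Lemma continuous_points (S : topologicalType) (A : set Omega) (f : S -> A) :
  (forall x, continuous (fun s => points (f s) x)) -> continuous f.
Proof.
move=> cf; do 2! apply: continuous_comp_initial.
exact: continuous_prod cf.
Qed.

(** * Membership in [B(r,N)] *)

Lemma residue_val (N : supernatural) (r : Zmods N) (a b : divisors_of N) :
  val a = val b -> r a = r b :> nat.
Proof. by move=> /val_inj ->. Qed.

Lemma BsetP (N : supernatural) (r : Zmods N) (m : nat) (a : posnat) :
  reflect (exists aN : dvds (supernatural_of a) N,
             m %% a = r (mk_divisor aN))
          (Bset r (m, a)).
Proof.
apply: (iffP idP) => [/asboolP[d /= da md]|[aN ma]]; last first.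
  exact: (mem_Bset (a := mk_divisor aN)).
have aN : dvds (supernatural_of a) N by rewrite -da; exact: (set_mem (valP d)).
exists aN; rewrite -[X in _ %% nat_of_posnat X]da md.
exact: residue_val.
Qed.

Lemma Bset_hereditary (N : supernatural) (r : Zmods N) : hereditary (Bset r).
Proof. by have [] := Bset_Omega r. Qed.

Lemma Bset_dvd (N : supernatural) (r : Zmods N) (m : nat) (a b : posnat) :
  a %| b -> Bset r (m, b) -> Bset r (m, a).
Proof.
by move=> ab /Bset_hereditary; apply; rewrite /le_semi /= leqnn subnn dvdn0.
Qed.

Lemma Bset_supernatural (N : supernatural) (r : Zmods N) (m : nat)
  (a : posnat) : Bset r (m, a) -> dvds (supernatural_of a) N.
Proof. by case/BsetP. Qed.

(** One element over [a] reveals the class [r(a)] and with it the whole fibre, so later arguments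
    need not mention residues of [r]. *)
Lemma Bset_mod (N : supernatural) (r : Zmods N) (m n : nat) (a : posnat) :
  Bset r (m, a) -> Bset r (n, a) = (m == n %[mod a]).
Proof.
move=> /BsetP[aN ma]; apply/BsetP/eqP => [[aN' na]|mn].
  by rewrite ma na; exact: residue_val.
by exists aN; rewrite -mn.
Qed.

Lemma Bset_ex (N : supernatural) (r : Zmods N) (a : posnat) :
  dvds (supernatural_of a) N -> exists m, Bset r (m, a).
Proof.
by move=> aN; exists (r (mk_divisor aN)); apply/BsetP; exists aN;
  rewrite modn_small.
Qed.

Lemma Bset1 (N : supernatural) (r : Zmods N) (m : nat) (a : posnat) :
  nat_of_posnat a = 1 -> Bset r (m, a).
Proof.
move=> a1; have [n na] := Bset_ex r (dvds_one N a1).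
by rewrite (Bset_mod _ na) a1 !modn1.
Qed.

(** The class [r(a)] is read off from any [m] with [A (m, a)]: the third hypothesis makes it well
    defined, the fourth makes these classes compatible under reduction. *)
Lemma Bset_of (N : supernatural) (A : semi -> bool) :
  (forall m a, A (m, a) -> dvds (supernatural_of a) N) ->
  (forall a, dvds (supernatural_of a) N -> exists m, A (m, a)) ->
  (forall m n a, A (m, a) -> A (n, a) = (m == n %[mod a])) ->
  (forall m (a b : posnat), a %| b -> A (m, b) -> A (m, a)) ->
  exists r : Zmods N, A = Bset r.
Proof.
move=> AN Aex Amod Advd.
have [x xP] :
    {x : divisors_of N -> nat & forall a : divisors_of N, A (x a, val a)}.
  exact: (choice (fun a : divisors_of N => Aex (val a) (set_mem (valP a)))).
have lt_mod (a : divisors_of N) : x a %% val a < val a.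
  by rewrite ltn_mod posnat_gt0.
have compat (a b : divisors_of N) : val a %| val b ->
    Ordinal (lt_mod b) %% val a = Ordinal (lt_mod a).
  move=> ab /=; rewrite modn_dvdm //.
  by apply/eqP; rewrite -(Amod _ _ (val a)) //; exact: Advd ab (xP b).
exists (MkZmods compat); apply/funext => -[m a].
apply/idP/BsetP => [Am|[aN /= /eqP]].
  by exists (AN _ _ Am); apply/eqP; rewrite /= -(Amod _ _ a).
by rewrite eq_sym -(Amod _ _ a) //; exact: xP (mk_divisor aN).
Qed.

(** * Prime-power parts of integers and supernatural numbers *)

Lemma prime_prime (p : primes_type) : prime p.
Proof. exact: valP p. Qed.

Lemma ppart_gt0 (p : primes_type) (a : posnat) : 0 < a`_p.
Proof. exact: part_gt0. Qed.

Definition ppart (p : primes_type) (a : posnat) : posnat :=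
  Sub a`_p (ppart_gt0 p a).

Lemma ppartE (p : primes_type) (a : posnat) : ppart p a = a`_p :> nat.
Proof. by []. Qed.

Definition prime_factors (a : posnat) : seq primes_type :=
  pmap insub (primes a).

Lemma mem_prime_factors (p : primes_type) (a : posnat) :
  (p \in prime_factors a) = (p %| a).
Proof.
by rewrite mem_pmap_sub mem_primes posnat_gt0 prime_prime.
Qed.

Lemma prime_factors_uniq (a : posnat) : uniq (prime_factors a).
Proof. exact/pmap_sub_uniq/primes_uniq. Qed.

Lemma ppart_eq1 (p : primes_type) (a : posnat) :
  ~~ (p %| a) -> ppart p a = 1 :> nat.
Proof.
move=> pa; rewrite ppartE p_part; case: (posnP (logn p a)) => [->//|].
by rewrite logn_gt0 mem_primes (negPf pa) !andbF.
Qed.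

Lemma ppart_pnat (p : primes_type) (a : posnat) :
  p.-nat a -> ppart p a = a.
Proof. by move=> pa; apply: val_inj; rewrite [LHS]ppartE part_pnat_id. Qed.

Lemma dvdn_ppart (p : primes_type) (a b : posnat) :
  a %| b -> ppart p a %| ppart p b.
Proof. by move=> ab; apply: partn_dvd => //; exact: posnat_gt0. Qed.

(** The uniqueness half of the Chinese remainder theorem; primes not dividing [a] contribute the
    trivial modulus 1. *)
Lemma eqmod_ppartP (m n : nat) (a : posnat) :
  reflect (forall p : primes_type, m = n %[mod ppart p a]) (m == n %[mod a]).
Proof.
apply: (iffP (modn_partP _ _ (posnat_gt0 a))) => mn p; last first.
  by rewrite mem_primes => /and3P[pp _ _]; exact: (mn (Sub p pp)).
have [pa|/ppart_eq1 ->] := boolP (p %| a); last by rewrite !modn1.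
by apply: mn; rewrite mem_primes posnat_gt0 pa prime_prime.
Qed.

Lemma dvds_ppart (N : supernatural) (a : posnat) :
  dvds (supernatural_of a) N <->
  forall p, dvds (supernatural_of (ppart p a)) (ppow p (N p)).
Proof.
split=> aN p.
  move=> q; rewrite /supernatural_of /ppow ppartE p_part val_eqE.
  have [->|qp] := eqVneq q p; last first.
    rewrite lognX (logn_prime _ (prime_prime p)).
    by rewrite (negPf (qp : nat_of_prime q != p)) muln0.
  by rewrite pfactorK ?prime_prime //; exact: aN.
by have := aN p p; rewrite /supernatural_of /ppow eqxx ppartE logn_part.
Qed.

Lemma dvds_ppow (p : primes_type) (N : supernatural) (a : posnat) :
  dvds (supernatural_of a) (ppow p (N p)) <->
  dvds (supernatural_of a) N /\ p.-nat a.
Proof.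
split=> [aN|[aN pa]].
  split; first exact: dvds_trans aN (ppow_dvds p N).
  apply/pnatP => [|q qp qa]; first exact: posnat_gt0.
  have := aN (Sub q qp); rewrite /supernatural_of /ppow /=.
  case: eqP => [qE _|_ /=]; first by apply/eqP.
  by rewrite /nat_of_prime /= leqNgt logn_gt0 mem_primes qp posnat_gt0 qa.
by rewrite -(ppart_pnat pa); move/dvds_ppart: aN; exact.
Qed.

(** * Splitting [B(r,N)] into [p]-components and gluing them *)

Lemma Bset_pnat (p : primes_type) (k : exponent) (s : Zmods (ppow p k))
  (m : nat) (a : posnat) : Bset s (m, a) -> p.-nat a.
Proof.
(* [ppow p k] is seen as [ppow p (N p)] for the [N] with all exponents equal to [k]. *)
by move=> /Bset_supernatural/(@dvds_ppow p (fun=> k) a)[].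
Qed.

(** The [p]-component of [f], expressed through the set alone and hence independent of the pair
    [(r,N)] presenting it. *)
Definition primary (p : primes_type) (A : semi -> bool) : semi -> bool :=
  fun x => A x && p.-nat x.2.

Lemma Bset_res (p : primes_type) (N : supernatural) (r : Zmods N) :
  Bset (res (ppow_dvds p N) r) = primary p (Bset r).
Proof.
apply/funext => -[m a]; apply/BsetP/andP => [[aN ma]|[/BsetP[aN ma] pa]].
  split; last by have [] := (dvds_ppow p N a).1 aN.
  apply/BsetP; exists (dvds_trans aN (ppow_dvds p N)).
  rewrite ma.
  exact: (@residue_val _ r (widen_divisor (ppow_dvds p N) (mk_divisor aN))).
exists ((dvds_ppow p N a).2 (conj aN pa)); rewrite ma.
exact: residue_val.
Qed.

(* The primes not dividing [x.2] would only ask for [A p (x.1, 1)]; leaving them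
   out makes [glue] visibly depend on finitely many coordinates. *)
Definition glue (A : primes_type -> semi -> bool) : semi -> bool :=
  fun x => all (fun p => A p (x.1, ppart p x.2)) (prime_factors x.2).

Lemma glueP (A : primes_type -> semi -> bool) (m : nat) (a : posnat) :
  (forall p m (a : posnat), nat_of_posnat a = 1 -> A p (m, a)) ->
  reflect (forall p, A p (m, ppart p a)) (glue A (m, a)).
Proof.
move=> A1; apply: (iffP allP) => Aa p; last by move=> _; exact: Aa.
have [pa|/ppart_eq1] := boolP (p %| a); last exact: A1.
by apply: Aa; rewrite mem_prime_factors.
Qed.

Lemma glue_primary (N : supernatural) (r : Zmods N) :
  glue (fun p => primary p (Bset r)) = Bset r.
Proof.
apply/funext => -[m a]; apply/glueP/idP => [p n b b1|rp|ra p]; last first.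
- rewrite /primary [X in _.-nat X]ppartE part_pnat andbT.
  by apply: Bset_dvd ra; exact: dvdn_part.
- have aN : dvds (supernatural_of a) N.
    apply/dvds_ppart => p; apply/dvds_ppow.
    by have /andP[/Bset_supernatural] := rp p.
  (* The reference element [n] over [a] agrees with [m] modulo every [ppart p a], hence modulo
     [a]. *)
  have [n rn] := Bset_ex r aN.
  rewrite (Bset_mod _ rn); apply/eqmod_ppartP => p; apply/eqP.
  have /andP[rm _] := rp p.
  rewrite -(@Bset_mod _ r) //; apply: Bset_dvd rn; exact: dvdn_part.
- by rewrite /primary Bset1 //= b1.
Qed.

Lemma primary_glue (N : supernatural) (s : forall p, Zmods (ppow p (N p)))
  (p : primes_type) : primary p (glue (fun q => Bset (s q))) = Bset (s p).
Proof.
have s1 q m (a : posnat) : nat_of_posnat a = 1 -> Bset (s q) (m, a).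
  exact: Bset1.
apply/funext => -[m a]; apply/andP/idP => [[/(glueP _ _ s1)/(_ p)]|spa].
  by move=> + /ppart_pnat => /[swap] ->.
have pa := Bset_pnat spa; split=> //; apply/glueP => // q.
have [->|qp] := eqVneq q p; first by rewrite ppart_pnat.
(* A prime [q] other than [p] cannot divide the [p]-power [a], so its condition is the trivial one
   modulo 1. *)
apply: s1; apply: ppart_eq1; apply: contra qp => qa.
by have /pnatP/(_ _ (valP q) qa) := pa; rewrite inE => /(_ (posnat_gt0 a)).
Qed.

(** The existence half of the Chinese remainder theorem: over a divisor [a] of [N], the classes
    prescribed at the finitely many primes dividing [a] share an element. *)
Lemma Bset_glue (N : supernatural) (s : forall p, Zmods (ppow p (N p))) :
  exists r : Zmods N, glue (fun p => Bset (s p)) = Bset r.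
Proof.
have s1 q m (a : posnat) : nat_of_posnat a = 1 -> Bset (s q) (m, a).
  exact: Bset1.
apply: Bset_of => [m a /(glueP _ _ s1) sa|a aN|m n a /(glueP _ _ s1) sm|].
- by apply/dvds_ppart => p; exact: Bset_supernatural (sa p).
- have [t tP] :
      {t : primes_type -> nat & forall p, Bset (s p) (t p, ppart p a)}.
    exact: (choice (fun p => Bset_ex (s p) ((dvds_ppart N a).1 aN p))).
  have [||m mP] := @chinese_seq _ (prime_factors a) (ppart^~ a) t.
  + exact: prime_factors_uniq.
  + move=> p q _ _ pq; rewrite !ppartE !p_part coprimeXl // coprimeXr //.
    by rewrite prime_coprime ?prime_prime // dvdn_prime2 ?prime_prime.
  + exists m; apply/allP => p ps /=.
    by rewrite (Bset_mod _ (tP p)) mP.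
- apply/(glueP _ _ s1)/eqmod_ppartP => sn p.
    by apply/eqP; rewrite -(Bset_mod _ (sm p)).
  by rewrite (Bset_mod _ (sm p)) sn.
- move=> m a b ab /(glueP _ _ s1) sb; apply/glueP => // p.
  by apply: Bset_dvd (sb p); exact: dvdn_ppart.
Qed.

(** * Transfer to the spaces [OmegaB] and [Xp p] *)

Lemma OmegaB_Bbd (x : OmegaB) : exists N (r : Zmods N), x = Bbd r.
Proof.
have [N [r xr]] := set_mem (valP x); exists N, r; exact: val_inj.
Qed.

Lemma Xp_Bloc (p : primes_type) (x : Xp p) :
  exists k (s : Zmods (ppow p k)), x = Bloc s.
Proof.
have [k [s xs]] := set_mem (valP x); exists k, s; exact: val_inj.
Qed.

Lemma Xp_primary (p : primes_type) (x : OmegaB) :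
  exists y : Xp p, points y = primary p (points x).
Proof.
have [N [r ->]] := OmegaB_Bbd x.
by exists (Bloc (res (ppow_dvds p N) r)); exact: Bset_res.
Qed.

Lemma Xp_glue (y : forall p, Xp p) :
  exists x : OmegaB, points x = glue (fun p => points (y p)) /\
    forall p, primary p (points x) = points (y p).
Proof.
(* The exponents of all the [y p] together form one supernatural number [N]. *)
have [N NP] := choice (fun p => Xp_Bloc (y p)).
pose s p := projT1 (cid (NP p)).
have ys p : points (y p) = Bset (s p) by rewrite {1}(projT2 (cid (NP p))).
have [r rE] := Bset_glue s.
have ysE : (fun p => points (y p)) = (fun p => Bset (s p)) by exact/funext.
exists (Bbd r); rewrite ysE; split=> // p.
by rewrite ys -primary_glue rE.
Qed.

Theorem proposition5p11 :
  exists f : OmegaB -> prod_topology (fun p : primes_type => Xp p),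
    (forall (N : supernatural) (r : Zmods N),
        f (Bbd r) = fun p : primes_type => Bloc (res (ppow_dvds p N) r)) /\
    homeomorphism f.
Proof.
(* The choice is harmless: by [points_inj] a point is determined by its subset of P. *)
pose f (x : OmegaB) : prod_topology (fun p : primes_type => Xp p) :=
  fun p => projT1 (cid (Xp_primary p x)).
pose g (y : prod_topology (fun p : primes_type => Xp p)) : OmegaB :=
  projT1 (cid (Xp_glue y)).
have fE x p : points (f x p) = primary p (points x).
  exact: projT2 (cid (Xp_primary p x)).
have gE y : points (g y) = glue (fun p => points (y p)).
  by have [] := projT2 (cid (Xp_glue y)).
have gK y p : primary p (points (g y)) = points (y p).
  by have [] := projT2 (cid (Xp_glue y)).
exists f; split.
  move=> N r; apply: functional_extensionality_dep => p; apply: points_inj.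
  by rewrite fE -[RHS]/(Bset _) Bset_res.
split.
  apply: continuous_prod => p; apply: continuous_points => x.
  (* The factor [p.-nat x.2] is constant in [y], so only the coordinate [x] of [y] matters. *)
  apply/continuous_boolP => y; rewrite fE /primary.
  have /continuous_boolP/(_ y) := @points_continuous OmegaB x.
  by apply: filterS => z; rewrite fE /primary => ->.
exists g; split.
- move=> x; apply: points_inj; rewrite gE.
  rewrite (_ : (fun p => _) = fun p => primary p (points x)); last exact/funext.
  by have [N [r ->]] := OmegaB_Bbd x; exact: glue_primary.
- move=> y; apply: functional_extensionality_dep => p; apply: points_inj.
  by rewrite fE gK.
- apply: continuous_points => x.
  have -> : (fun y => points (g y) x) =
      (fun y => glue (fun p => points (y p)) x).
    by apply/funext => y; rewrite gE.
  (* For fixed [x], [glue] is a conjunction over the prime factors of [x.2], each term being one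
     coordinate of one [y p]. *)
  apply: continuous_all => p y.
  apply: (continuous_comp
    (f := fun y : prod_topology (fun p : primes_type => Xp p) => y p)
    (g := fun z : Xp p => points z (x.1, ppart p x.2))).
    exact: (@proj_continuous _ (fun p : primes_type => Xp p) p).
  exact: points_continuous.
Qed.
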